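(* The following problem is decidable: given Fibonacci-synchronized sequences $(a(n))_{n\ge0}$ and $(b(n))_{n\ge0}$ (each specified by a synchronized automaton), decide whether $(a(n))_{n\ge 0}$ is a permutation of $(b(n))_{n\ge 0}$, i.e., whether there is a bijection $\sigma:\mathbb{N}\to\mathbb{N}$ with $a(n)=b(\sigma(n))$ for all $n$.
   Context: $\mathbb{N}=\{0,1,2,\ldots\}$. The Fibonacci (Zeckendorf) representation of $n\in\mathbb{N}$ is the binary string $e_1\cdots e_t$ with no two consecutive $1$'s and $n=\sum_{i=1}^t e_iF_{t-i+2}$ (where $F_0=0,F_1=1,F_k=F_{k-1}+F_{k-2}$), leading zeros being allowed/ignored. A sequence $s:\mathbb{N}\to\mathbb{N}$ is Fibonacci-synchronized if there is a deterministic finite automaton over the alphabet $\{0,1\}^2$ which, reading the Fibonacci representations of a pair $(n,x)$ in parallel (most significant digit first, the shorter one padded with leading zeros), accepts if and only if $x=s(n)$; such an automaton is called a synchronized automaton for $s$. *)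

(* Defs.v *)
From mathcomp Require Import all_boot.
Set Implicit Arguments. Unset Strict Implicit. Unset Printing Implicit Defensive.

Fixpoint fib (k : nat) : nat :=
  match k with
  | 0 => 0
  | 1 => 1
  | (k'.+1 as k1).+1 => fib k1 + fib k'
  end.

Fixpoint fib_valid (w : seq bool) : bool :=
  match w with
  | x :: ((y :: _) as w') => ~~ (x && y) && fib_valid w'
  | _ => true
  end.

Fixpoint fib_val (w : seq bool) : nat :=
  match w with
  | [::] => 0
  | e :: w' => e * fib (size w' + 2) + fib_val w'
  end.

(* Letter (e, f) in {0,1}^2 is coded as 2e + f in {0,1,2,3}.
   States are natural numbers; the transition from state q on letter c is
   the entry 4q + c of the table [delta] (0 if absent); state q is
   accepting iff entry q of [final] is true.  Every reachable state is the
   start state or an entry of [delta], so each record is a genuine DFA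
   (finitely many states), and every DFA arises this way. *)
Record dfa := Dfa { start : nat; delta : seq nat; final : seq bool }.

Definition letter (p : bool * bool) : nat := 2 * p.1 + p.2.

Definition run (D : dfa) (w : seq nat) : nat :=
  foldl (fun q c => nth 0 (delta D) (4 * q + c)) (start D) w.

Definition accepts (D : dfa) (w : seq nat) : bool := nth false (final D) (run D w).

(* D is a synchronized automaton for s: reading in parallel Fibonacci
   representations u of n and v of x (msd first, padded with leading zeros
   to a common length; leading zeros allowed), D accepts iff x = s n. *)
Definition synchronized (D : dfa) (s : nat -> nat) : Prop :=
  forall u v : seq bool, size u = size v -> fib_valid u -> fib_valid v ->
    accepts D (map letter (zip u v)) = (fib_val v == s (fib_val u)).

Definition is_permutation (a b : nat -> nat) : Prop :=
  exists sigma : nat -> nat, bijective sigma /\ forall n, a n = b (sigma n).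

Inductive prec_fun : Type :=
  | PZero
  | PSucc
  | PProj of nat
  | PComp of prec_fun & seq prec_fun
  | PRec of prec_fun & prec_fun
  | PMu of prec_fun.

Inductive peval : prec_fun -> seq nat -> nat -> Prop :=
  | pev_zero v : peval PZero v 0
  | pev_succ v : peval PSucc v (nth 0 v 0).+1
  | pev_proj i v : peval (PProj i) v (nth 0 v i)
  | pev_comp f gs v ws y :
      pevals gs v ws -> peval f ws y -> peval (PComp f gs) v y
  | pev_rec0 f g v y : peval f v y -> peval (PRec f g) (0 :: v) y
  | pev_recS f g n v r y :
      peval (PRec f g) (n :: v) r -> peval g (n :: r :: v) y ->
      peval (PRec f g) (n.+1 :: v) y
  | pev_mu f v n :
      peval f (n :: v) 0 ->
      (forall m, m < n -> exists k, peval f (m :: v) k.+1) ->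
      peval (PMu f) v n
with pevals : seq prec_fun -> seq nat -> seq nat -> Prop :=
  | pevs_nil v : pevals [::] v [::]
  | pevs_cons g gs v y ys :
      peval g v y -> pevals gs v ys -> pevals (g :: gs) v (y :: ys).

Definition cpair (x y : nat) : nat := (x + y) * (x + y).+1 %/ 2 + y.

Fixpoint code_seq (l : seq nat) : nat :=
  match l with
  | [::] => 0
  | x :: l' => (cpair x (code_seq l')).+1
  end.

Definition enc_dfa (D : dfa) : nat :=
  code_seq [:: start D; code_seq (delta D); code_seq (map nat_of_bool (final D))].

(* Main.v *)
Require Import Defs.
From mathcomp Require Import all_boot all_order all_algebra.
From mathcomp Require Import zify.
Set Implicit Arguments. Unset Strict Implicit. Unset Printing Implicit Defensive.
Import GRing.Theory Num.Theory.

(** [a] is a permutation of [b] iff every [x] has equally many preimages under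
    both.  For a word [v] of value [x], let [N(v, k)] be the number of words [u]
    of length [k + |v|] accepted against [0^k v]; it counts the preimages of [x]
    below a Fibonacci number and increases with [k].  If the automaton, extended
    so as to check validity, has [T] states, pumping inside the padding shows
    that [x] has infinitely many preimages iff [N(v, T) < N(v, 2T)], and has
    exactly [N(v, T)] of them otherwise.  The set of states responsible for
    infinitely many preimages is tracked by a subset automaton, and [N(v, T)] is
    a linear functional of a vector transformed linearly by each letter of [v].
    Hence the discrepancy between [a] and [b] at [v] is a rational series of
    dimension at most [(2^T)^2 * 2T], which vanishes as soon as it vanishes on
    the words of length at most its dimension.  This is a bounded, hence
    primitive recursive, test. *)

(** * Automata reading pairs of words *)

Fixpoint words (n : nat) : seq (seq bool) :=
  if n is n'.+1 then
    map (cons false) (words n') ++ map (cons true) (words n')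
  else [:: [::]].

Lemma mem_words n w : (w \in words n) = (size w == n).
Proof.
elim: n w => [|n IH] w; first by case: w.
have inj (b : bool) : injective (cons b) by move=> s t [].
rewrite /= mem_cat; case: w => [|b w].
  by apply/negbTE; rewrite negb_or; apply/andP; split; apply/mapP => -[].
have other c : (b == c) = false -> (b :: w \in map (cons c) (words n)) = false.
  by move=> bc; apply/mapP => -[s _ [e _]]; rewrite e eqxx in bc.
case: b other => other.
  by rewrite (other false) // (mem_map (inj true)) IH.
by rewrite (other true) // orbF (mem_map (inj false)) IH.
Qed.

Lemma uniq_words n : uniq (words n).
Proof.
have inj (b : bool) : injective (cons b) by move=> s t [].
elim: n => //= n IH; rewrite cat_uniq !map_inj_uniq // IH andbT /=.
by apply/hasPn => _ /mapP[s _ ->]; apply/mapP => -[].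
Qed.

(** [words] grows at the head whereas a run is extended at its last letter; this reordering lets the
    recursion for [areach] peel off the last letter. *)
Lemma perm_words_rcons n :
  perm_eq (words n.+1) [seq rcons w b | w <- words n, b <- [:: false; true]].
Proof.
apply: uniq_perm; first exact: uniq_words.
  apply: allpairs_uniq => //; first exact: uniq_words.
  by move=> [x b] [y c] _ _ /= /rcons_inj.
move=> w; rewrite mem_words; apply/eqP/allpairsP => [|[[x b] /= [xn _ ->]]].
  case: (lastP w) => // x b; rewrite size_rcons => -[xn].
  by exists (x, b); split; rewrite ?mem_words ?xn //; case: b.
by rewrite size_rcons; move: xn; rewrite mem_words => /eqP ->.
Qed.

Section Automaton.

Variables (Q : finType) (q0 : Q) (step : Q -> bool -> bool -> Q) (acc : pred Q).

Definition arun (q : Q) (u v : seq bool) : Q :=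
  foldl (fun q p => step q p.1 p.2) q (zip u v).

(** Only [v] is padded with zeros; [u] fills the whole padded length, so raising [k] admits larger
    values of [u] against the same [v]. *)
Definition asol (v : seq bool) (k : nat) : seq (seq bool) :=
  [seq u <- words (k + size v) | acc (arun q0 u (nseq k false ++ v))].

Definition acount v k := size (asol v k).

Lemma arun_cat q u1 u2 v1 v2 : size u1 = size v1 ->
  arun q (u1 ++ u2) (v1 ++ v2) = arun (arun q u1 v1) u2 v2.
Proof. by move=> e; rewrite /arun zip_cat // foldl_cat. Qed.

Lemma arun_rcons q u v b c : size u = size v ->
  arun q (rcons u b) (rcons v c) = step (arun q u v) b c.
Proof. by move=> e; rewrite -!cats1 arun_cat. Qed.

Hypothesis pad0 : forall u v, size u = size v ->
  acc (arun q0 (false :: u) (false :: v)) = acc (arun q0 u v).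

Definition ajump v k : pred (seq bool) :=
  fun u => acc (arun q0 (true :: u) (false :: nseq k false ++ v)).

(** By [pad0], the words starting with 0 are those already counted at [k]; the words starting with 1
    are exactly the new ones. *)
Lemma acountS v k :
  acount v k.+1 = acount v k + count (ajump v k) (words (k + size v)).
Proof.
rewrite /acount /asol !size_filter addSn /= count_cat !count_map; congr (_ + _).
apply: eq_in_count => u; rewrite mem_words /= => /eqP su.
by rewrite pad0 // size_cat size_nseq.
Qed.

Lemma acount_leq v : {homo acount v : k l / k <= l}.
Proof.
by apply: homo_leq => // [? ? ? /leq_trans|k]; [apply | rewrite acountS leq_addr].
Qed.

Lemma acount_ltP v k :
  reflect (exists2 u, size u = k + size v & ajump v k u)
          (acount v k < acount v k.+1).
Proof.
rewrite acountS -{1}[acount v k]addn0 ltn_add2l -has_count.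
apply: (iffP hasP) => -[u].
  by rewrite mem_words => /eqP; exists u.
by move=> su ju; exists u; rewrite ?mem_words ?su.
Qed.

(* Repeating or deleting the loop between two prefixes of the padding that
   reach the same state. *)
Lemma acount_pump v k : #|Q| <= k -> acount v k < acount v k.+1 ->
  exists p, [/\ 0 < p <= #|Q|, acount v (k - p) < acount v (k - p).+1
              & acount v (k + p) < acount v (k + p).+1].
Proof.
move=> Qk /acount_ltP[u su ju].
pose s (i : 'I_#|Q|.+1) := arun q0 (true :: take i u) (false :: nseq i false).
have /injectivePn[i [j ne eqs]] : ~~ injectiveb s.
  by apply/negP => /injectiveP/leq_card; rewrite card_ord ltnn.
wlog ltij : i j ne eqs / i < j => [W|].
  have := ne; rewrite -val_eqE neq_ltn => /orP[] lt; first exact: (W i j).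
  by apply: (W j i) => //; rewrite eq_sym.
have jQ : j <= #|Q| by rewrite -ltnS.
have ui : size (take i u) = i by rewrite size_takel // su; lia.
have uj : size (take j u) = j by rewrite size_takel // su; lia.
(* Surgery on the padding: the first [t] letters after the leading 1 give way to any [x] reaching
   the same state, and the padding length is adjusted. *)
have run_drop (x : seq bool) n t : size x = n ->
    arun q0 (true :: x) (false :: nseq n false) = s t -> t <= k ->
    ajump v (n + (k - t)) (x ++ drop t u).
  move=> sx ex tk.
  rewrite /ajump nseqD -catA -!cat_cons arun_cat /= ?sx ?size_nseq // ex /s.
  rewrite -arun_cat; last first.
    by rewrite /= size_nseq size_takel // su (leq_trans tk) ?leq_addr.
  rewrite !cat_cons.
  by rewrite cat_take_drop catA -nseqD subnKC.
exists (j - i); split; first by lia.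
  apply/acount_ltP; exists (take i u ++ drop j u).
    by rewrite size_cat ui size_drop su; lia.
  have := @run_drop (take i u) i j ui eqs (leq_trans jQ Qk).
  by have -> : i + (k - j) = k - (j - i) by lia.
apply/acount_ltP; exists (take j u ++ drop i u).
  by rewrite size_cat uj size_drop su; lia.
have := @run_drop (take j u) j i uj (esym eqs) (leq_trans (ltnW ltij) (leq_trans jQ Qk)).
by have -> : j + (k - i) = k + (j - i) by lia.
Qed.

Lemma acount_lt_jump v k l : acount v k < acount v l ->
  exists2 j, k <= j < l & acount v j < acount v j.+1.
Proof.
elim: l => [|l IH] lt.
  by have := acount_leq v (leq0n k); lia.
have kl : k <= l.
  by rewrite leqNgt; apply/negP => /(acount_leq v); lia.
case: (ltnP (acount v l) (acount v l.+1)) => [h|le]; first by exists l => //; lia.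
have /IH[j jl hj] : acount v k < acount v l by exact: leq_trans lt le.
by exists j => //; lia.
Qed.

Lemma acount_bounded v : acount v (2 * #|Q|) <= acount v #|Q| ->
  forall k, #|Q| <= k -> acount v k = acount v #|Q|.
Proof.
move=> le.
have noinc k : #|Q| <= k -> ~~ (acount v k < acount v k.+1).
  elim/ltn_ind: k => k IH Qk; apply/negP => lt.
  (* An increase at [k >= 2 * #|Q|] pumps down to an earlier one that is still at least [#|Q|],
     excluded by induction; below [2 * #|Q|] the hypothesis [le] and monotonicity leave no room for
     an increase. *)
  case: (leqP (2 * #|Q|) k) => h.
    have [p [/andP[p0 pQ] lt' _]] := acount_pump Qk lt.
    by move: lt'; apply/negP; apply: IH; lia.
  have := acount_leq v Qk; have := acount_leq v h; lia.
elim=> [|k IH]; first by rewrite leqn0 => /eqP ->.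
rewrite leq_eqVlt => /orP[/eqP -> //|]; rewrite ltnS => Qk.
have := noinc k Qk; have := acount_leq v (leqnSn k); rewrite (IH Qk); lia.
Qed.

(** An increase at some [j >= #|Q|] pumps upwards again and again, and each increase adds at least
    one solution. *)
Lemma acount_unbounded v : acount v #|Q| < acount v (2 * #|Q|) ->
  forall M, exists k, M <= acount v k.
Proof.
case/acount_lt_jump => j /andP[Qj _] ltj.
elim=> [|M [k Mk]]; first by exists 0.
have [l [kl Ql ltl]] : exists l, [/\ k <= l, #|Q| <= l & acount v l < acount v l.+1].
  elim: k {M Mk} => [|k [l [kl Ql ltl]]]; first by exists j.
  have [p [/andP[p0 _] _ lt']] := acount_pump Ql ltl.
  by exists (l + p); split=> //; lia.
by exists l.+1; have := acount_leq v kl; lia.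
Qed.

Definition next_set (S : {set Q}) (f : bool) : {set Q} :=
  [set step q e f | q in S, e in [set: bool]].

(* By pumping, padding lengths in [#|Q|, 2 * #|Q|) witness all longer ones. *)
Definition jump_set : {set Q} :=
  [set q | has (fun k => has (fun u => arun q0 (true :: u) (nseq k.+1 false) == q)
                           (words k)) (iota #|Q| #|Q|)].

Lemma foldl_next_setP (S : {set Q}) v q :
  reflect (exists p u, [/\ p \in S, size u = size v & arun p u v = q])
          (q \in foldl next_set S v).
Proof.
apply: (iffP idP).
  elim/last_ind: v q => [|v f IH] q; first by exists q, [::].
  rewrite foldl_rcons => /imset2P[r e /IH[p [u [pS su <-]]] _ ->].
  by exists p, (rcons u e); rewrite !size_rcons su arun_rcons.
case=> p [u [pS su <-]].
elim/last_ind: v u su => [|v f IH] u; first by case: u.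
case: (lastP u) => [|u' e]; rewrite !size_rcons // => -[su].
by rewrite foldl_rcons arun_rcons //; apply: imset2_f (IH _ su) _; rewrite inE.
Qed.

(** Cutting an accepted run where the padding ends leaves a state of [jump_set] followed by a run
    over [v], in which the subset automaton guesses [u]. Growth of the count is thus detected by a
    finite control reading [v]. *)
Lemma jump_setP v :
  (acount v #|Q| < acount v (2 * #|Q|))
  = [exists q, (q \in foldl next_set jump_set v) && acc q].
Proof.
apply/idP/existsP.
  case/acount_lt_jump => k kQ /acount_ltP[u su ju].
  exists (arun q0 (true :: u) (false :: nseq k false ++ v)); rewrite [acc _]ju andbT.
  apply/foldl_next_setP.
  exists (arun q0 (true :: take k u) (nseq k.+1 false)), (drop k u); split.
  - rewrite inE; apply/hasP; exists k; first by rewrite mem_iota; lia.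
    by apply/hasP; exists (take k u); rewrite // mem_words size_takel ?su ?leq_addr.
  - by rewrite size_drop su addKn.
  rewrite -arun_cat /= ?size_nseq ?size_takel ?su ?leq_addr //.
  by rewrite cat_take_drop.
case=> q /andP[/foldl_next_setP[p [w [pS sw <-]]] accq].
move: pS; rewrite inE => /hasP[k]; rewrite mem_iota => kQ /hasP[u].
rewrite mem_words => /eqP su /eqP pE.
have : acount v k < acount v k.+1.
  apply/acount_ltP; exists (u ++ w); first by rewrite size_cat su sw.
  rewrite /ajump -!cat_cons arun_cat /= ?su ?size_nseq //.
  by move: accq; rewrite -pE.
have [Qk k2] : #|Q| <= k /\ k.+1 <= 2 * #|Q| by lia.
have := acount_leq v Qk; have := acount_leq v k2; lia.
Qed.

Definition areach (v : seq bool) (q : Q) : nat :=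
  count (fun u => arun q0 u (nseq #|Q| false ++ v) == q) (words (#|Q| + size v)).

Lemma acount_reach v : acount v #|Q| = \sum_q areach v q * acc q.
Proof.
rewrite /acount /asol size_filter /areach.
rewrite -sum1_count big_mkcond /=.
under [RHS]eq_bigr => q _ do rewrite -sum1_count big_mkcond big_distrl /=.
rewrite exchange_big /=; apply: eq_bigr => u _.
rewrite (bigD1 (arun q0 u (nseq #|Q| false ++ v))) //= eqxx big1 => [|q ne].
  by rewrite addn0 mul1n; case: (acc _).
by rewrite eq_sym (negbTE ne).
Qed.

(** The vector [areach v] is multiplied by a matrix depending only on the letter [f]: its entry at
    [q], [q'] counts the letters [e] leading from [q] to [q']. *)
Lemma areach_rcons v f q' :
  areach (rcons v f) q' = \sum_q areach v q * \sum_(e : bool) (step q e f == q').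
Proof.
rewrite /areach size_rcons addnS (permP (perm_words_rcons _)) count_flatten.
rewrite sumnE big_map big_map.
under [RHS]eq_bigr => q _ do rewrite -sum1_count big_mkcond big_distrl /=.
rewrite exchange_big /= big_seq [RHS]big_seq; apply: eq_bigr => u.
rewrite mem_words => /eqP su.
have sz : size u = size (nseq #|Q| false ++ v) by rewrite su size_cat size_nseq.
rewrite (bigD1 (arun q0 u (nseq #|Q| false ++ v))) //= eqxx.
rewrite [X in _ = _ + X]big1 => [|q ne].
  by rewrite addn0 mul1n -rcons_cat !arun_rcons // big_bool /=; lia.
by rewrite eq_sym (negbTE ne).
Qed.

End Automaton.

(** * Linear representations *)

Section LinearRepresentation.

Local Open Scope ring_scope.

Lemma linear_orbit_vanish (n : nat) (x : seq bool -> 'rV[rat]_n)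
    (M : bool -> 'M[rat]_n) (phi : 'cV[rat]_n) :
  (forall v f, x (rcons v f) = x v *m M f) ->
  (forall v, (size v <= n)%N -> x v *m phi = 0) ->
  forall v, x v *m phi = 0.
Proof.
move=> xM small.
(* [V k] spans the vectors [x v] with [size v <= k]; once two consecutive
   spaces agree the chain is stationary, and its rank can grow at most [n]
   times. *)
pose V := fix V k : 'M[rat]_n :=
  if k is k'.+1 then (V k' + (V k' *m M false + V k' *m M true))%MS
  else <<x [::]>>%MS.
have VS k : (V k <= V k.+1)%MS by apply: addsmxSl.
have VM k f : (V k *m M f <= V k.+1)%MS.
  by apply: submx_trans (addsmxSr _ _); case: f; rewrite ?addsmxSl ?addsmxSr.
have x0V k : (x [::] <= V k)%MS.
  elim: k => [|k IH]; first by rewrite /= genmxE.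
  exact: submx_trans IH (VS k).
(* Quantified over [psi] because reading a letter replaces [psi] by [M f *m psi]. *)
have Vphi k (psi : 'cV[rat]_n) :
    (forall v, (size v <= k)%N -> x v *m psi = 0) -> V k *m psi = 0.
  elim: k psi => [|k IH] psi H; apply/sub_kermxP.
    by rewrite genmxE; apply/sub_kermxP; apply: H.
  have VMpsi f : (V k *m M f <= kermx psi)%MS.
    apply/sub_kermxP; rewrite -mulmxA; apply: IH => v lev.
    by rewrite mulmxA -xM H // size_rcons.
  rewrite /= !addsmx_sub !VMpsi !andbT; apply/sub_kermxP; apply: IH => v lev.
  by rewrite H // ltnW.
have [k kn stab] : exists2 k, (k <= n)%N & (V k.+1 <= V k)%MS.
  case: (boolP [exists k : 'I_n.+1, (V k.+1 <= V k)%MS]).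
    by case/existsP => k; exists k => //; rewrite -ltnS.
  rewrite negb_exists => /forallP nstab.
  have rk k : (k <= n.+1)%N -> (k <= \rank (V k))%N.
    elim: k => // k IH ltk; apply: leq_ltn_trans (IH (ltnW ltk)) _.
    by apply: rank_ltmx; rewrite /ltmx VS (nstab (Ordinal ltk)).
  by have := leq_trans (rk n.+1 (leqnn _)) (rank_leq_col _); rewrite ltnn.
have xVk v : (x v <= V k)%MS.
  elim/last_ind: v => [|v f IH]; first exact: x0V.
  by rewrite xM; apply: submx_trans stab; apply: submx_trans (VM k f); apply: submxMr.
move=> v; apply/sub_kermxP; apply: submx_trans (xVk v) _; apply/sub_kermxP.
by apply: Vphi => w lew; apply: small; apply: leq_trans lew kn.
Qed.

Lemma linear_sum_vanish (S : finType) (y : seq bool -> S -> rat)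
    (W : bool -> S -> S -> rat) (phi : S -> rat) :
  (forall v f s', y (rcons v f) s' = \sum_s y v s * W f s s') ->
  (forall v, (size v <= #|S|)%N -> \sum_s y v s * phi s = 0) ->
  forall v, \sum_s y v s * phi s = 0.
Proof.
move=> yW small.
pose x v : 'rV[rat]_#|S| := \row_i y v (enum_val i).
pose M f : 'M[rat]_#|S| := \matrix_(i, j) W f (enum_val i) (enum_val j).
pose p : 'cV[rat]_#|S| := \col_i phi (enum_val i).
have xp v : x v *m p = (\sum_s y v s * phi s)%:M.
  apply/matrixP => i j; rewrite !ord1 !mxE mulr1n (reindex (@enum_val S S)) /=.
    by apply: eq_bigr => k _; rewrite !mxE.
  exact: onW_bij (@enum_val_bij S).
have xM v f : x (rcons v f) = x v *m M f.
  apply/matrixP => i j; rewrite !mxE yW (reindex (@enum_val S S)) /=.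
    by apply: eq_bigr => k _; rewrite !mxE.
  exact: onW_bij (@enum_val_bij S).
move=> v; have /matrixP/(_ ord0 ord0) : x v *m p = 0.
  by apply: (linear_orbit_vanish xM) => w sw; rewrite xp small // raddf0.
by rewrite xp !mxE mulr1n.
Qed.

(* A finite control is absorbed into the linear representation by taking
   one copy of the coordinates for each control state. *)
Lemma controlled_sum_vanish (C S : finType) (c0 : C) (next : C -> bool -> C)
    (y : seq bool -> S -> rat) (W : bool -> S -> S -> rat)
    (phi : C -> S -> rat) :
  let h v := \sum_s y v s * phi (foldl next c0 v) s in
  (forall v f s', y (rcons v f) s' = \sum_s y v s * W f s s') ->
  (forall v, (size v <= #|C| * #|S|)%N -> h v = 0) -> forall v, h v = 0.
Proof.
move=> h yW; rewrite -card_prod => small v.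
(* The copy of the coordinates belonging to the current control state carries [y v]; all other
   copies are zero. *)
pose z v (cs : C * S) := (foldl next c0 v == cs.1)%:R * y v cs.2.
pose W' f (cs cs' : C * S) := (next cs.1 f == cs'.1)%:R * W f cs.2 cs'.2.
have sumz (G : C * S -> rat) w :
    \sum_cs z w cs * G cs = \sum_s y w s * G (foldl next c0 w, s).
  rewrite (eq_bigr (fun cs => z w (cs.1, cs.2) * G (cs.1, cs.2))); last by case.
  rewrite -(pair_bigA _ (fun c s => z w (c, s) * G (c, s))) /=.
  rewrite (bigD1 (foldl next c0 w)) //= [X in _ + X]big1 ?addr0.
    by apply: eq_bigr => s _; rewrite /z eqxx mul1r.
  move=> c ne; apply: big1 => s _.
  by rewrite /z eq_sym (negbTE ne) !mul0r.
rewrite /h -(sumz (fun cs => phi cs.1 cs.2)).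
apply: (@linear_sum_vanish _ z W') => [w f [c s]|w sw];
  last by rewrite sumz; apply: small.
rewrite sumz /= /z /W' foldl_rcons /= yW big_distrr /=.
by apply: eq_bigr => t _; rewrite mulrCA.
Qed.

End LinearRepresentation.

(** * Comparing the counts of two automata *)

Section Compare.

Variables (Q : finType) (q0 : bool -> Q) (step : bool -> Q -> bool -> bool -> Q).
Variable acc : bool -> pred Q.
Hypothesis pad0 : forall b u v, size u = size v ->
  acc b (arun (step b) (q0 b) (false :: u) (false :: v))
  = acc b (arun (step b) (q0 b) u v).

Local Notation N b := (acount (q0 b) (step b) (acc b)).

Definition ainf b v := N b v #|Q| < N b v (2 * #|Q|).

Definition amatch v :=
  (ainf true v == ainf false v)
  && (ainf true v || (N true v #|Q| == N false v #|Q|)).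

(** Unbounded counts dominate everything, and bounded counts are constant from [#|Q|] on. The
    lengths [k] and [k'] are independent, as in the domination of prefix counts that characterizes
    permutations. *)
Lemma amatchP v :
  reflect (forall b k, exists k', N b v k <= N (~~ b) v k') (amatch v).
Proof.
apply: (iffP idP) => [/andP[/eqP einf eqN] b k|dom].
  have einfb : ainf b v = ainf (~~ b) v by case: b; rewrite einf.
  case: (boolP (ainf (~~ b) v)) => [/(acount_unbounded (@pad0 _))|fin]; first exact.
  (* Passing to [maxn k #|Q|] reaches the range where a bounded count is constant. *)
  exists #|Q|; apply: leq_trans (_ : N b v (maxn k #|Q|) <= _).
    by apply: (acount_leq (@pad0 _)); rewrite leq_maxl.
  rewrite (acount_bounded (@pad0 _)) ?leq_maxr //;
    last by rewrite leqNgt -/(ainf b v) einfb.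
  move: fin eqN; rewrite -einfb.
  by case: (b) => /=; rewrite -?einf => /negbTE -> /= /eqP ->.
have infW b : ainf b v -> ainf (~~ b) v.
  move=> infb; apply/negPn/negP => fin.
  have [k] := acount_unbounded (@pad0 _) infb (N (~~ b) v #|Q|).+1.
  have [k' le] := dom b k; move/leq_trans/(_ le); apply/negP; rewrite -leqNgt.
  apply: leq_trans (_ : N (~~ b) v (maxn k' #|Q|) <= _).
    by apply: (acount_leq (@pad0 _)); rewrite leq_maxl.
  by rewrite (acount_bounded (@pad0 _)) ?leq_maxr // leqNgt.
have einf : ainf true v = ainf false v by apply/idP/idP; apply: infW.
rewrite /amatch einf eqxx /=; case: (boolP (ainf false v)) => //= fin.
have le b : N b v #|Q| <= N (~~ b) v #|Q|.
  have [k' le] := dom b #|Q|; apply: leq_trans le _.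
  apply: leq_trans (_ : N (~~ b) v (maxn k' #|Q|) <= _).
    by apply: (acount_leq (@pad0 _)); rewrite leq_maxl.
  rewrite (acount_bounded (@pad0 _)) ?leq_maxr // leqNgt.
  by case: (b); rewrite /= -/(ainf _ v) ?einf.
by rewrite eqn_leq (le true) (le false).
Qed.

(** Each of the two subset automata on [Q] has [2 ^ #|Q|] states; the reach vectors of both automata
    together have [2 * #|Q|] coordinates. *)
Definition control_bound := 2 ^ #|Q| * 2 ^ #|Q| * (2 * #|Q|).

Lemma amatch_bounded :
  (forall v, size v <= control_bound -> amatch v) -> forall v, amatch v.
Proof.
move=> small.
pose C := ({set Q} * {set Q})%type.
pose next (c : C) f : C := (next_set (step true) c.1 f, next_set (step false) c.2 f).
pose c0 : C := (jump_set (q0 true) (step true), jump_set (q0 false) (step false)).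
pose isinf b (A : {set Q}) := [exists q, (q \in A) && acc b q].
have foldC v : foldl next c0 v = (foldl (next_set (step true)) c0.1 v,
                                  foldl (next_set (step false)) c0.2 v).
  by elim/last_ind: v => [|v f IH] //; rewrite !foldl_rcons IH.
have infT v : isinf true (foldl next c0 v).1 = ainf true v.
  by rewrite foldC /ainf (jump_setP (@pad0 _)).
have infF v : isinf false (foldl next c0 v).2 = ainf false v.
  by rewrite foldC /ainf (jump_setP (@pad0 _)).
have Q0 : 0 < #|Q| by apply/card_gt0P; exists (q0 true).
have cardC : #|{: C}| = 2 ^ #|Q| * 2 ^ #|Q|.
  by rewrite card_prod -cardsT -powersetT card_powerset cardsT.
(* The infinity flags are compared first, by a series with a single constant coordinate, so that all
   information lies in the control. *)
have einf v : ainf true v = ainf false v.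
  pose phi (c : C) (_ : unit) : rat := (isinf true c.1 != isinf false c.2)%:R%R.
  have sum1 w : (\sum_s 1 * phi (foldl next c0 w) s = (ainf true w != ainf false w)%:R)%R.
    rewrite (bigD1 tt) //= big1 => [|[] //].
    by rewrite mul1r addr0 /phi infT infF.
  suff : (\sum_s 1 * phi (foldl next c0 v) s = 0)%R.
    by rewrite sum1 => /eqP; case: (ainf true v =P ainf false v).
  apply: (@controlled_sum_vanish C unit c0 next (fun _ _ => 1%R)
    (fun _ _ _ => 1%R) phi) => [_ _ _|w sw].
    by rewrite (bigD1 tt) //= big1 => [|[] //]; rewrite mulr1 addr0.
  have /small/andP[/eqP ew _] : size w <= control_bound.
    by apply: leq_trans sw _; rewrite cardC card_unit leq_mul //; lia.
  by rewrite sum1 ew eqxx.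
pose y v (bq : bool * Q) : rat := (areach (q0 bq.1) (step bq.1) v bq.2)%:R%R.
pose W f (s s' : bool * Q) : rat := ((s.1 == s'.1)%:R *
  (\sum_(e : bool) (step s.1 s.2 e f == s'.2))%N%:R)%R.
(* Control states signalling infinitely many preimages are sent to 0, since [amatch] then makes no
   demand on the counts; elsewhere the sign turns the sum into the difference of the two counts. *)
pose phi (c : C) (bq : bool * Q) : rat :=
  (if isinf true c.1 then 0 else (-1) ^+ bq.1 * (acc bq.1 bq.2)%:R)%R.
have sumE w : (\sum_s y w s * phi (foldl next c0 w) s =
    if ainf true w then 0 else (N false w #|Q|)%:R - (N true w #|Q|)%:R)%R.
  rewrite /phi infT; case: (ainf true w); first by apply: big1 => s _; rewrite mulr0.
  rewrite (eq_bigr (fun s => (y w (s.1, s.2) * ((-1) ^+ s.1 * (acc s.1 s.2)%:R)))%R);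
    last by case.
  rewrite -(pair_bigA _ (fun b q => y w (b, q) * ((-1) ^+ b * (acc b q)%:R))%R) /=.
  rewrite big_bool /= addrC !acount_reach !natr_sum -sumrN; congr (_ + _)%R;
    apply: eq_bigr => q _; rewrite /y /= natrM.
    by rewrite expr0 mul1r.
  by rewrite expr1 mulN1r mulrN.
move=> v; rewrite /amatch einf eqxx /=.
case: (boolP (ainf false v)) => //= fin.
suff : (\sum_s y v s * phi (foldl next c0 v) s = 0)%R.
  by rewrite sumE einf (negbTE fin) => /eqP; rewrite subr_eq0 eqr_nat eq_sym.
apply: (@controlled_sum_vanish C (bool * Q)%type c0 next y W phi) => [w f [b q']|w sw].
  rewrite (eq_bigr (fun s => y w (s.1, s.2) * W f (s.1, s.2) (b, q'))%R); last by case.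
  rewrite -(pair_bigA _ (fun c q => y w (c, q) * W f (c, q) (b, q'))%R) /=.
  rewrite (bigD1 b) //= [X in (_ + X)%R]big1 => [|c ne].
    rewrite addr0 /y /= areach_rcons natr_sum; apply: eq_bigr => q _.
    by rewrite /W /= eqxx mul1r natrM.
  by apply: big1 => q _; rewrite /W /= (negbTE ne) mul0r mulr0.
have /small/andP[_] : size w <= control_bound.
  by apply: leq_trans sw _; rewrite cardC card_prod card_bool.
by rewrite sumE; case: (ainf true w) => //= /eqP ->; rewrite subrr.
Qed.

End Compare.

(** * Occurrences of values and Fibonacci representations *)

Definition occ (a : nat -> nat) (x k : nat) : nat := \sum_(i < k) (a i == x).

Lemma occS a x k : occ a x k.+1 = occ a x k + (a k == x).
Proof. by rewrite /occ big_ord_recr. Qed.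

Lemma occ_leq a x : {homo occ a x : k l / k <= l}.
Proof. by apply: homo_leq => // [? ? ? /leq_trans|k]; [apply|rewrite occS leq_addr]. Qed.

(** The prefix count rises by at most one at a time, so occurrence number [r] of [x], counted from
    0, sits at some position [m]. *)
Lemma occ_index a x r k : r < occ a x k -> exists m, (a m == x) && (occ a x m == r).
Proof.
elim: k => [|k IH]; first by rewrite /occ big_ord0.
rewrite occS; case: (ltnP r (occ a x k)) => [/IH //|le].
by case: eqP => [axk|_] lt; [exists k; apply/andP; split; apply/eqP; lia | lia].
Qed.

Lemma occ_inj a x m m' : a m = x -> a m' = x -> occ a x m = occ a x m' -> m = m'.
Proof.
move=> am am' e; case: (ltngtP m m') => // /(occ_leq a x);
  rewrite occS ?am ?am' eqxx; lia.
Qed.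

Lemma occ_image a b sigma x k : injective sigma -> (forall n, a n = b (sigma n)) ->
  exists k', occ a x k <= occ b x k'.
Proof.
(* The prefix of [b] must reach beyond the images of all indices below [k]. *)
move=> inj ab; exists (\max_(i < k) sigma i).+1; set K := _.+1.
have lt (i : 'I_k) : sigma i < K by rewrite ltnS; apply: (leq_bigmax i).
pose f i : 'I_K := Ordinal (lt i).
have finj : injective f by move=> i j /(congr1 val)/= /inj/val_inj.
have -> : occ a x k = \sum_(j in f @: setT) (b j == x).
  rewrite big_imset /=; last by move=> i j _ _ /finj.
  by apply: eq_big => [i|i _]; rewrite ?inE // ab.
by rewrite /occ [leqRHS](bigID (mem (f @: setT))) /= leq_addr.
Qed.

(** The bijection sends occurrence number [r] of a value in [a] to occurrence number [r] of the same
    value in [b]. Domination makes this occurrence exist, and the symmetric construction is the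
    inverse. *)
Lemma is_permutationP a b :
  is_permutation a b <->
  (forall x k, exists k', occ a x k <= occ b x k')
  /\ (forall x k, exists k', occ b x k <= occ a x k').
Proof.
split=> [[s [[t st ts] ab]]|[domab domba]].
  split=> x k; first by apply: (occ_image _ _ (can_inj st)).
  by apply: (occ_image _ _ (can_inj ts)) => n; rewrite ab ts.
have pick c d : (forall x k, exists k', occ c x k <= occ d x k') ->
    forall n, exists m, (d m == c n) && (occ d (c n) m == occ c (c n) n).
  move=> dom n; have [k' le] := dom (c n) n.+1.
  by apply: (@occ_index _ _ _ k'); apply: leq_trans le; rewrite occS eqxx addn1.
pose s n := ex_minn (pick a b domab n); pose t n := ex_minn (pick b a domba n).
have sP n : b (s n) = a n /\ occ b (a n) (s n) = occ a (a n) n.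
  by rewrite /s; case: ex_minnP => m /andP[/eqP -> /eqP ->].
have tP n : a (t n) = b n /\ occ a (b n) (t n) = occ b (b n) n.
  by rewrite /t; case: ex_minnP => m /andP[/eqP -> /eqP ->].
exists s; split=> [|n]; last by have [] := sP n.
exists t => n.
  have [e1 e2] := sP n; have [e3 e4] := tP (s n).
  by apply: (@occ_inj a (a n)); rewrite ?e3 -?e1 // e4 e1.
have [e1 e2] := tP n; have [e3 e4] := sP (t n).
by apply: (@occ_inj b (b n)); rewrite ?e3 -?e1 // e4 e1.
Qed.

(** * Fibonacci numbers and Zeckendorf words *)

Local Arguments fib : simpl never.

Lemma fibSS n : fib n.+2 = fib n.+1 + fib n.
Proof. by []. Qed.

Lemma fib_gt0 n : 0 < fib n.+1.
Proof. by elim: n => // n IH; rewrite fibSS ltn_addr. Qed.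

Lemma fib_leqS n : fib n.+1 <= fib n.+2.
Proof. by rewrite fibSS leq_addr. Qed.

Lemma fib_unbounded n : n <= fib n.+2.
Proof.
elim: n => // n IH; rewrite fibSS; have := fib_gt0 n; lia.
Qed.

Lemma fib_valid_cons b w : fib_valid (b :: w) -> fib_valid w.
Proof. by case: w => //= c w /andP[]. Qed.

Lemma fib_val_lt w : fib_valid w -> fib_val w < fib (size w).+2.
Proof.
(* Induction on a bound for the length, since a leading 1 takes the following 0 with it and two
   letters disappear. *)
move: {2}(size w) (leqnn (size w)) => n; elim: n w => [|n IH] [|[] w] //.
  case: w => [|[] w] // lew vw.
  have := IH w (ltnW lew) (fib_valid_cons (fib_valid_cons vw)).
  by rewrite /= !addn2 mul1n mul0n add0n (fibSS (size w).+2); lia.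
move=> lew /fib_valid_cons/(IH _ lew); rewrite /= mul0n add0n.
by move=> /leq_trans; apply; apply: fib_leqS.
Qed.

(** By [fib_val_lt] a tail is worth less than a leading 1, so the value determines the leading
    digit. *)
Lemma fib_val_inj u v : size u = size v -> fib_valid u -> fib_valid v ->
  fib_val u = fib_val v -> u = v.
Proof.
elim: u v => [|b u IH] [|c v] //= [suv] vu vv.
have := fib_val_lt (fib_valid_cons vu); have := fib_val_lt (fib_valid_cons vv).
rewrite suv addn2; case: b c vu vv => [] [] vu vv ltv ltu;
  rewrite ?mul1n ?mul0n => e; try lia.
all: by rewrite (IH v) ?(fib_valid_cons vu) ?(fib_valid_cons vv) //; lia.
Qed.

(** Greedy choice: if [x] reaches the weight of the first digit, the remainder is so small that the
    second digit can be 0. *)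
Lemma fib_val_surj n x : x < fib n.+2 ->
  exists w, [/\ size w = n, fib_valid w & fib_val w = x].
Proof.
elim/ltn_ind: n x => [[|[|n]] IH] x ltx.
- by exists [::]; split=> //; move: ltx; case: x.
- by exists [:: x == 1]; split=> //; move: ltx; case: x => [|[]].
case: (ltnP x (fib n.+3)) => le.
  have [w [sw vw <-]] := IH n.+1 (leqnn _) x le.
  by exists (false :: w); split; rewrite /= ?sw //; case: (w) vw.
have [|w [sw vw ew]] := IH n (leqW (leqnn _)) (x - fib n.+3).
  by move: ltx; rewrite fibSS; lia.
exists [:: true, false & w]; split; rewrite /= ?sw //; first by case: (w) vw.
by rewrite ew !addn2 mul1n mul0n; lia.
Qed.

Lemma fib_val_words n :
  perm_eq [seq fib_val u | u <- words n & fib_valid u] (iota 0 (fib n.+2)).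
Proof.
apply: uniq_perm; last first.
- move=> x; rewrite mem_iota add0n /=.
  apply/mapP/idP => [[u]|/fib_val_surj[w [sw vw ew]]].
    by rewrite mem_filter mem_words => /andP[vu /eqP <-] ->; apply: fib_val_lt.
  by exists w; rewrite // mem_filter mem_words vw sw /=.
- exact: iota_uniq.
rewrite map_inj_in_uniq; first by rewrite filter_uniq // uniq_words.
move=> u v; rewrite !mem_filter !mem_words => /andP[vu /eqP su] /andP[vv /eqP sv].
by apply: fib_val_inj => //; rewrite su sv.
Qed.

Lemma count_fib_words a x n :
  count (fun u => fib_valid u && (a (fib_val u) == x)) (words n) = occ a x (fib n.+2).
Proof.
rewrite (eq_count (a2 := predI (preim fib_val (fun i => a i == x)) fib_valid));
  last first.
  by move=> u; rewrite /= andbC.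
rewrite -count_filter -count_map (permP (fib_val_words n)).
rewrite -sum1_count big_mkcond /occ /=.
rewrite -(big_mkord xpredT (fun i => nat_of_bool (a i == x))) /index_iota subn0.
by apply: eq_bigr => i _; case: eqP.
Qed.

(** * Computability *)

(** The arity is fixed because passing the parameters on to a subprogram takes an explicit list of
    projections. *)
Definition computable (n : nat) (f : seq nat -> nat) : Prop :=
  exists P, forall v, size v = n -> peval P v (f v).

Lemma computable_eq n f g :
  (forall v, f v = g v) -> computable n f -> computable n g.
Proof. by move=> fg [P HP]; exists P => v sv; rewrite -fg; apply: HP. Qed.

Lemma computable_var n i : computable n (fun v => nth 0 v i).
Proof. by exists (PProj i) => v _; constructor. Qed.

Lemma computable_nth_behead n (X : seq nat -> seq nat) i :
  computable n (fun v => nth 0 (X v) i.+1) ->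
  computable n (fun v => nth 0 (behead (X v)) i).
Proof. by apply: computable_eq => v; rewrite nth_behead. Qed.

Lemma pevals_projs s v : pevals (map PProj s) v (map (nth 0 v) s).
Proof. by elim: s => [|i s IH]; constructor=> //; constructor. Qed.

Lemma map_nth_iota v n : size v = n -> map (nth 0 v) (iota 0 n) = v.
Proof. by move=> <-; apply: mkseq_nth. Qed.

Lemma computable_comp1 n h f :
  computable 1 (fun v => h (nth 0 v 0)) -> computable n f ->
  computable n (fun v => h (f v)).
Proof.
move=> [Ph Hh] [Pf Hf]; exists (PComp Ph [:: Pf]) => v sv.
apply: (@pev_comp _ _ _ [:: f v]); last exact: (Hh [:: f v]).
by do !constructor; apply: Hf.
Qed.

Lemma computable_comp2 n h f g :
  computable 2 (fun v => h (nth 0 v 0) (nth 0 v 1)) ->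
  computable n f -> computable n g ->
  computable n (fun v => h (f v) (g v)).
Proof.
move=> [Ph Hh] [Pf Hf] [Pg Hg]; exists (PComp Ph [:: Pf; Pg]) => v sv.
apply: (@pev_comp _ _ _ [:: f v; g v]); last exact: (Hh [:: f v; g v]).
by do !constructor; [apply: Hf | apply: Hg].
Qed.

(** Primitive recursion in the form used for all later functions: the step sees the counter, the
    accumulator, then the parameters. *)
Lemma computable_iteri n b (s : nat -> nat -> seq nat -> nat) c :
  computable n b -> computable n c ->
  computable n.+2 (fun w => s (nth 0 w 0) (nth 0 w 1) (behead (behead w))) ->
  computable n (fun v => iteri (c v) (fun i r => s i r v) (b v)).
Proof.
move=> [Pb Hb] [Pc Hc] [Ps Hs].
exists (PComp (PRec Pb Ps) (Pc :: map PProj (iota 0 n))) => v sv.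
apply: (@pev_comp _ _ _ (c v :: v)).
  constructor; first exact: Hc.
  by rewrite -{2}(map_nth_iota sv); apply: pevals_projs.
elim: (c v) => [|k IH] /=; first by constructor; apply: Hb.
apply: pev_recS IH _.
by apply: (Hs [:: k, iteri k (fun i r => s i r v) (b v) & v]); rewrite /= sv.
Qed.

Lemma computable_succ n f : computable n f -> computable n (fun v => (f v).+1).
Proof. by apply: computable_comp1; exists PSucc => v _; constructor. Qed.

Lemma computable_const n k : computable n (fun _ => k).
Proof.
elim: k => [|k IH]; last exact: computable_succ.
by exists PZero => v _; constructor.
Qed.

Lemma computable_pred n f : computable n f -> computable n (fun v => (f v).-1).
Proof.
apply: computable_comp1.
apply: (@computable_eq _ (fun v => iteri (nth 0 v 0) (fun i _ => i) 0)).
  by move=> v; case: (nth 0 v 0).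
apply: (@computable_iteri _ _ (fun i _ _ => i));
  [exact: computable_const | exact: computable_var | exact: computable_var].
Qed.

Lemma computable_add n f g :
  computable n f -> computable n g -> computable n (fun v => f v + g v).
Proof.
move=> cf cg.
apply: (@computable_eq _ (fun v => iteri (f v) (fun _ r => r.+1) (g v))).
  by move=> v; elim: (f v) => //= k ->.
apply: (@computable_iteri _ _ (fun _ r _ => r.+1)) => //.
by apply: computable_succ; apply: computable_var.
Qed.

Lemma computable_sub n f g :
  computable n f -> computable n g -> computable n (fun v => f v - g v).
Proof.
move=> cf cg.
apply: (@computable_eq _ (fun v => iteri (g v) (fun _ r => r.-1) (f v))).
  by move=> v; elim: (g v) => [|k /= ->]; rewrite ?subn0 ?subnS.
apply: (@computable_iteri _ _ (fun _ r _ => r.-1)) => //.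
by apply: computable_pred; apply: computable_var.
Qed.

Lemma computable_mul n f g :
  computable n f -> computable n g -> computable n (fun v => f v * g v).
Proof.
apply: (@computable_comp2 n muln).
apply: (@computable_eq _
  (fun v => iteri (nth 0 v 0) (fun _ r => nth 0 v 1 + r) 0)).
  by move=> v; elim: (nth 0 v 0) => //= k ->; rewrite mulSn.
apply: (@computable_iteri _ _ (fun _ r v => nth 0 v 1 + r));
  [exact: computable_const | exact: computable_var |].
by apply: computable_add; do ?apply: computable_nth_behead;
  apply: computable_var.
Qed.

Lemma computable_exp2 n f : computable n f -> computable n (fun v => 2 ^ f v).
Proof.
move=> cf.
apply: (@computable_eq _ (fun v => iteri (f v) (fun _ r => 2 * r) 1)).
  by move=> v; elim: (f v) => //= k ->; rewrite expnS.
apply: (@computable_iteri _ _ (fun _ r _ => 2 * r)) => //.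
  exact: computable_const.
by apply: computable_mul; [apply: computable_const | apply: computable_var].
Qed.

Lemma computable_leq n f g :
  computable n f -> computable n g -> computable n (fun v => f v <= g v).
Proof.
move=> cf cg; apply: (@computable_eq _ (fun v => 1 - (f v - g v))).
  by move=> v; lia.
by apply: computable_sub; [apply: computable_const | apply: computable_sub].
Qed.

Lemma computable_negb n (p : seq nat -> bool) :
  computable n p -> computable n (fun v => ~~ p v).
Proof.
move=> cp; apply: (@computable_eq _ (fun v => 1 - p v)).
  by move=> v; case: (p v).
by apply: computable_sub => //; apply: computable_const.
Qed.

Lemma computable_andb n (p q : seq nat -> bool) :
  computable n p -> computable n q -> computable n (fun v => p v && q v).
Proof.
move=> cp cq; apply: (@computable_eq _ (fun v => p v * q v)).
  by move=> v; case: (p v) (q v) => [] [].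
exact: computable_mul.
Qed.

Lemma computable_orb n (p q : seq nat -> bool) :
  computable n p -> computable n q -> computable n (fun v => p v || q v).
Proof.
move=> cp cq; apply: (@computable_eq _ (fun v => ~~ (~~ p v && ~~ q v))).
  by move=> v; rewrite negb_and !negbK.
by apply: computable_negb; apply: computable_andb; apply: computable_negb.
Qed.

Lemma computable_eqn n f g :
  computable n f -> computable n g -> computable n (fun v => f v == g v).
Proof.
move=> cf cg; apply: (@computable_eq _ (fun v => (f v <= g v) && (g v <= f v))).
  by move=> v; rewrite eqn_leq.
by apply: computable_andb; apply: computable_leq.
Qed.

Lemma computable_sum n b (F : nat -> seq nat -> nat) :
  computable n b ->
  computable n.+1 (fun w => F (nth 0 w 0) (behead w)) ->
  computable n (fun v => \sum_(i < b v) F i v).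
Proof.
move=> cb [PF HF].
apply: (@computable_eq _ (fun v => iteri (b v) (fun i r => r + F i v) 0)).
  by move=> v; elim: (b v) => [|k /= ->]; rewrite ?big_ord0 ?big_ord_recr.
apply: (@computable_iteri _ _ (fun i r v => r + F i v)) => //.
  exact: computable_const.
apply: computable_add; first exact: computable_var.
(* The summand does not take the accumulator, so position 1 is skipped among the projections. *)
exists (PComp PF (PProj 0 :: map PProj (iota 2 n))) => w sw.
case: w sw => [|i [|r v]] //= [sv].
apply: (@pev_comp _ _ _ (i :: v)); last by apply: (HF (i :: v)); rewrite /= sv.
constructor; first exact: pev_proj.
have := pevals_projs (iota 2 n) [:: i, r & v].
by rewrite -[2]/(2 + 0) iotaDl -[map (nth 0 _) _]map_comp
  (map_nth_iota sv : map (nth 0 [:: i, r & v] \o addn 2) _ = v).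
Qed.

Lemma computable_odd n f : computable n f -> computable n (fun v => odd (f v)).
Proof.
move=> cf; apply: (@computable_eq _ (fun v => iteri (f v) (fun _ r => 1 - r) 0)).
  by move=> v; elim: (f v) => //= k ->; case: (odd k).
apply: (@computable_iteri _ _ (fun _ r _ => 1 - r)) => //.
  exact: computable_const.
by apply: computable_sub; [apply: computable_const | apply: computable_var].
Qed.

(** The floor of half a number counts the odd numbers below it, which reduces halving to a bounded
    sum. *)
Lemma computable_half n f : computable n f -> computable n (fun v => (f v)./2).
Proof.
move=> cf; apply: (@computable_eq _ (fun v => \sum_(j < f v) odd j)).
  move=> v; elim: (f v) => [|k IH]; first by rewrite big_ord0.
  by rewrite big_ord_recr /= IH uphalf_half addnC.
by apply: (@computable_sum _ _ (fun j _ => odd j)) => //;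
  apply: computable_odd; apply: computable_var.
Qed.

(* A word of length [n] is coded by a number below [2 ^ n], least significant bit
   first, so that padding with leading zeros is multiplication by a power of 2. *)
Definition bit (U i : nat) : bool := odd (iteri i (fun _ => half) U).

Lemma computable_bit n f g :
  computable n f -> computable n g -> computable n (fun v => bit (f v) (g v)).
Proof.
move=> cf cg; apply: computable_odd.
apply: (@computable_iteri _ _ (fun _ r _ => r./2)) => //.
by apply: computable_half; apply: computable_var.
Qed.

(** * Cantor pairing and coded lists *)

Definition fstp (z : nat) : nat :=
  \sum_(x < z.+1) \sum_(y < z.+1) x * (cpair x y == z).

Definition sndp (z : nat) : nat :=
  \sum_(x < z.+1) \sum_(y < z.+1) y * (cpair x y == z).

Lemma computable_cpair n f g :
  computable n f -> computable n g -> computable n (fun v => cpair (f v) (g v)).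
Proof.
move=> cf cg.
apply: (@computable_eq _ (fun v => ((f v + g v) * (f v + g v).+1)./2 + g v)).
  by move=> v; rewrite /cpair divn2.
by do ![exact: cf | exact: cg | apply: computable_add | apply: computable_half
       | apply: computable_mul | apply: computable_succ].
Qed.

Ltac computability := repeat
  lazymatch goal with
  | |- computable _ (fun _ => ?k) => exact: (computable_const _ k)
  | |- computable _ (fun v => nth 0 v ?i) => exact: (computable_var _ i)
  | |- computable _ (fun v => nth 0 (behead _) _) =>
      apply: computable_nth_behead
  | |- computable _ (fun v => S (@?f v)) => apply: (@computable_succ _ f)
  | |- computable _ (fun v => (@?f v).-1) => apply: (@computable_pred _ f)
  | |- computable _ (fun v => @?f v + @?g v) => apply: (@computable_add _ f g)
  | |- computable _ (fun v => @?f v - @?g v) => apply: (@computable_sub _ f g)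
  | |- computable _ (fun v => @?f v * @?g v) => apply: (@computable_mul _ f g)
  | |- computable _ (fun v => 2 ^ @?f v) => apply: (@computable_exp2 _ f)
  | |- computable _ (fun v => cpair (@?f v) (@?g v)) =>
      apply: (@computable_cpair _ f g)
  | |- computable _ (fun v => nat_of_bool (bit (@?f v) (@?g v))) =>
      apply: (@computable_bit _ f g)
  | |- computable _ (fun v => nat_of_bool (@?f v <= @?g v)) =>
      apply: (@computable_leq _ f g)
  | |- computable _ (fun v => nat_of_bool (@?f v == @?g v)) =>
      apply: (@computable_eqn _ f g)
  | |- computable _ (fun v => nat_of_bool (~~ @?f v)) =>
      apply: (@computable_negb _ f)
  | |- computable _ (fun v => nat_of_bool (@?f v && @?g v)) =>
      apply: (@computable_andb _ f g)
  | |- computable _ (fun v => nat_of_bool (@?f v || @?g v)) =>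
      apply: (@computable_orb _ f g)
  end.

Lemma computable_fstp n f : computable n f -> computable n (fun v => fstp (f v)).
Proof.
apply: computable_comp1.
apply: (@computable_sum _ _ (fun x v =>
  \sum_(y < (nth 0 v 0).+1) x * (cpair x y == nth 0 v 0))); computability.
apply: (@computable_sum _ _ (fun y v =>
  nth 0 v 0 * (cpair (nth 0 v 0) y == nth 0 (behead v) 0))); computability.
Qed.

Lemma computable_sndp n f : computable n f -> computable n (fun v => sndp (f v)).
Proof.
apply: computable_comp1.
apply: (@computable_sum _ _ (fun x v =>
  \sum_(y < (nth 0 v 0).+1) y * (cpair x y == nth 0 v 0))); computability.
apply: (@computable_sum _ _ (fun y v =>
  y * (cpair (nth 0 v 0) y == nth 0 (behead v) 0))); computability.
Qed.

(** Pairs with sum [s] get codes from the triangular number of [s] up to that number plus [s], still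
    below the next triangular number; the code thus determines the sum, and then [y]. *)
Lemma cpair_inj x y x' y' : cpair x y = cpair x' y' -> x = x' /\ y = y'.
Proof.
rewrite /cpair !divn2.
have tri s s' : s < s' -> (s * s.+1)./2 + s < (s' * s'.+1)./2.
  move=> ss'; have : (s.+1 * s.+2)./2 <= (s' * s'.+1)./2.
    by apply: half_leq; apply: leq_mul.
  suff -> : (s.+1 * s.+2)./2 = (s * s.+1)./2 + s.+1 by lia.
  have -> : s.+1 * s.+2 = s * s.+1 + (s.+1).*2 by lia.
  by rewrite halfD odd_double andbF doubleK.
by case: (ltngtP (x + y) (x' + y')) => [/tri|/tri|e]; rewrite ?e; lia.
Qed.

Lemma leq_cpairl x y : x <= cpair x y.
Proof.
rewrite /cpair divn2; case: x => // x; apply: leq_trans (leq_addr _ _).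
by rewrite geq_half_double; nia.
Qed.

Lemma leq_cpairr x y : y <= cpair x y.
Proof. exact: leq_addl. Qed.

(** [cpair] is injective and dominates both components, so the search range contains the pair and
    only its term survives in the double sum. *)
Lemma fstpK x y : fstp (cpair x y) = x.
Proof.
have hx : x < (cpair x y).+1 by rewrite ltnS leq_cpairl.
have hy : y < (cpair x y).+1 by rewrite ltnS leq_cpairr.
rewrite /fstp (bigD1 (Ordinal hx)) //= (bigD1 (Ordinal hy)) //= eqxx muln1.
rewrite !big1 ?addn0 // => [i ne|i ne].
  rewrite big1 // => j _; case: eqP => [/cpair_inj[e _]|]; last by rewrite muln0.
  by case/eqP: ne; apply: val_inj.
case: eqP => [/cpair_inj[_ e]|]; last by rewrite muln0.
by case/eqP: ne; apply: val_inj.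
Qed.

Lemma sndpK x y : sndp (cpair x y) = y.
Proof.
have hx : x < (cpair x y).+1 by rewrite ltnS leq_cpairl.
have hy : y < (cpair x y).+1 by rewrite ltnS leq_cpairr.
rewrite /sndp (bigD1 (Ordinal hx)) //= (bigD1 (Ordinal hy)) //= eqxx muln1.
rewrite !big1 ?addn0 // => [i ne|i ne].
  rewrite big1 // => j _; case: eqP => [/cpair_inj[e _]|]; last by rewrite muln0.
  by case/eqP: ne; apply: val_inj.
case: eqP => [/cpair_inj[_ e]|]; last by rewrite muln0.
by case/eqP: ne; apply: val_inj.
Qed.

(** The empty list has code 0, and [0.-1] equals [cpair 0 0]; reading beyond the end therefore keeps
    returning 0, the default used with [nth]. *)
Definition code_nth (c i : nat) : nat :=
  fstp (iteri i (fun _ r => sndp r.-1) c).-1.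

Lemma computable_code_nth n f g :
  computable n f -> computable n g ->
  computable n (fun v => code_nth (f v) (g v)).
Proof.
move=> cf cg; apply: computable_fstp; apply: computable_pred.
apply: (@computable_iteri _ _ (fun _ r _ => sndp r.-1)) => //.
by apply: computable_sndp; computability.
Qed.

Lemma code_nthE l i : code_nth (code_seq l) i = nth 0 l i.
Proof.
rewrite /code_nth.
have -> : iteri i (fun _ r => sndp r.-1) (code_seq l) = code_seq (drop i l).
  elim: i => [|i IH] /=; first by rewrite drop0.
  rewrite IH -addn1 addnC -drop_drop drop1.
  case: (drop i l) => [|x s] /=; last by rewrite sndpK.
  by rewrite -[0 in LHS]/(cpair 0 0) sndpK.
have -> : nth 0 l i = nth 0 (drop i l) 0 by rewrite nth_drop addn0.
by case: (drop i l) => [|x s]; [exact: (fstpK 0 0) | rewrite /= fstpK].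
Qed.

Definition run_code (E n U V : nat) : nat :=
  iteri n (fun j q => code_nth (code_nth E 1) (4 * q + (2 * bit U j + bit V j)))
    (code_nth E 0).

(* [bit (2 * U) j] is the letter preceding [bit U j], and 0 when [j = 0]. *)
Definition valid_code (n U : nat) : nat :=
  iteri n (fun j r => r * ~~ (bit (2 * U) j && bit U j)) 1.

Definition count_code (E n V : nat) : nat :=
  \sum_(U < 2 ^ n)
    code_nth (code_nth E 2) (run_code E n U V) * (valid_code n U * valid_code n V).

Lemma computable_valid_code n f g :
  computable n f -> computable n g ->
  computable n (fun v => valid_code (f v) (g v)).
Proof.
move=> cf cg.
apply: (@computable_comp2 n valid_code _ _ _ cf cg).
apply: (@computable_iteri _ _
  (fun j r v => r * ~~ (bit (2 * nth 0 v 1) j && bit (nth 0 v 1) j)));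
by computability.
Qed.

Lemma computable_comp4 n h f1 f2 f3 f4 :
  computable 4 (fun v => h (nth 0 v 0) (nth 0 v 1) (nth 0 v 2) (nth 0 v 3)) ->
  computable n f1 -> computable n f2 -> computable n f3 -> computable n f4 ->
  computable n (fun v => h (f1 v) (f2 v) (f3 v) (f4 v)).
Proof.
move=> [Ph Hh] [P1 H1] [P2 H2] [P3 H3] [P4 H4].
exists (PComp Ph [:: P1; P2; P3; P4]) => v sv.
apply: (@pev_comp _ _ _ [:: f1 v; f2 v; f3 v; f4 v]).
  by do !constructor; [apply: H1 | apply: H2 | apply: H3 | apply: H4].
exact: (Hh [:: f1 v; f2 v; f3 v; f4 v]).
Qed.

Lemma computable_run_code n f1 f2 f3 f4 :
  computable n f1 -> computable n f2 -> computable n f3 -> computable n f4 ->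
  computable n (fun v => run_code (f1 v) (f2 v) (f3 v) (f4 v)).
Proof.
apply: computable_comp4.
apply: (@computable_iteri _ _ (fun j q v =>
  code_nth (code_nth (nth 0 v 0) 1)
    (4 * q + (2 * bit (nth 0 v 2) j + bit (nth 0 v 3) j)))).
- by apply: computable_code_nth; computability.
- by computability.
by computability; apply: computable_code_nth; computability;
  apply: computable_code_nth; computability.
Qed.

Lemma computable_count_code n f g h :
  computable n f -> computable n g -> computable n h ->
  computable n (fun v => count_code (f v) (g v) (h v)).
Proof.
move=> cf cg ch.
apply: (@computable_comp4 n (fun a b c _ => count_code a b c) f g h h) => //.
apply: (@computable_sum _ _ (fun U v =>
  code_nth (code_nth (nth 0 v 0) 2) (run_code (nth 0 v 0) (nth 0 v 1) U (nth 0 v 2))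
  * (valid_code (nth 0 v 1) U * valid_code (nth 0 v 1) (nth 0 v 2))));
  computability.
  apply: computable_code_nth; last by apply: computable_run_code; computability.
  by apply: computable_code_nth; computability.
all: by apply: computable_valid_code; computability.
Qed.

(** * The decision procedure *)

Lemma fib_valid_rcons w b :
  fib_valid (rcons w b) = fib_valid w && ~~ (last false w && b).
Proof.
elim: w => [|x [|y w] IH] //=; first by rewrite andbT.
by rewrite -andbA -IH.
Qed.

Lemma fib_valid_pad k v : fib_valid (nseq k false ++ v) = fib_valid v.
Proof. by elim: k => //= k <-; case: (nseq k false ++ v). Qed.

Lemma fib_val_pad k v : fib_val (nseq k false ++ v) = fib_val v.
Proof. by elim: k => //= k ->. Qed.

(** * The product automaton checking validity *)

Section ProductAutomaton.

Variables (m : nat) (D : dfa).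

(** The bound [m] is a parameter, so that two automata can share one state type. *)
Definition pstate : finType := ('I_m.+1 * bool * bool * bool)%type.

(* The components are the state of [D], the last letter of each of the two
   words, and whether both words have been valid so far. *)
Definition pinit : pstate := (inord (start D), false, false, true).

Definition pstep (q : pstate) (e f : bool) : pstate :=
  let: (s, lu, lv, ok) := q in
  (inord (nth 0 (delta D) (4 * s + letter (e, f))), e, f,
   ok && (~~ (lu && e) && ~~ (lv && f))).

(** [synchronized] says nothing about invalid words, hence the validity flag in the acceptance
    condition. *)
Definition pacc (q : pstate) : bool := nth false (final D) q.1.1.1 && q.2.

Hypothesis startm : start D <= m.
Hypothesis deltam : forall i, nth 0 (delta D) i <= m.

Lemma run_leq w : run D w <= m.
Proof. by case: (lastP w) => [|w' c] //; rewrite /run foldl_rcons. Qed.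

Lemma arun_product u v : size u = size v ->
  arun pstep pinit u v = (inord (run D (map letter (zip u v))), last false u,
                          last false v, fib_valid u && fib_valid v).
Proof.
elim/last_ind: u v => [|u e IH] v; first by case: v.
case: (lastP v) => [|v' f]; rewrite !size_rcons // => -[suv].
rewrite arun_rcons // IH // zip_rcons // map_rcons !last_rcons.
rewrite !fib_valid_rcons /= inordK ?ltnS ?run_leq // /run foldl_rcons.
by congr (_, _, _, _); rewrite andbACA.
Qed.

Lemma pacc_arun u v : size u = size v ->
  pacc (arun pstep pinit u v)
  = accepts D (map letter (zip u v)) && (fib_valid u && fib_valid v).
Proof. by move=> suv; rewrite arun_product // /pacc /= inordK // ltnS run_leq. Qed.

Variables (a : nat -> nat).
Hypothesis syncD : synchronized D a.

Lemma pacc_sync u v : size u = size v ->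
  pacc (arun pstep pinit u v)
  = [&& fib_valid v, fib_valid u & a (fib_val u) == fib_val v].
Proof.
move=> suv; rewrite pacc_arun // andbC.
case: (boolP (fib_valid u)) => vu; last by rewrite andbF.
case: (boolP (fib_valid v)) => //= vv.
by rewrite syncD // eq_sym.
Qed.

(** This comes from the meaning of acceptance, not from the transition table: a leading zero changes
    neither value nor validity. *)
Lemma pacc_pad0 u v : size u = size v ->
  pacc (arun pstep pinit (false :: u) (false :: v)) = pacc (arun pstep pinit u v).
Proof.
move=> suv; rewrite !pacc_sync //; last by rewrite /= suv.
by rewrite (fib_valid_pad 1 u : fib_valid (false :: u) = _)
  (fib_valid_pad 1 v : fib_valid (false :: v) = _).
Qed.

(** Valid words of the padded length represent each number below a Fibonacci number exactly once.
    The factor [fib_valid v] makes all counts vanish at an invalid [v], which then matches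
    trivially. *)
Lemma acount_occ v k : acount pinit pstep pacc v k
  = fib_valid v * occ a (fib_val v) (fib (k + size v).+2).
Proof.
rewrite -count_fib_words /acount /asol size_filter.
rewrite (_ : count _ _ = count (fun u => fib_valid v &&
  (fib_valid u && (a (fib_val u) == fib_val v))) (words (k + size v))).
  by case: (fib_valid v); rewrite ?mul1n ?mul0n ?count_pred0.
apply: eq_in_count => u; rewrite mem_words => /eqP su.
by rewrite pacc_sync ?size_cat ?size_nseq // fib_valid_pad fib_val_pad.
Qed.

End ProductAutomaton.

Section Criterion.

Variables (m : nat) (A B : dfa) (a b : nat -> nat).
Let D (c : bool) := if c then A else B.
Let s (c : bool) := if c then a else b.

Hypothesis startm : forall c, start (D c) <= m.
Hypothesis deltam : forall c i, nth 0 (delta (D c)) i <= m.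
Hypothesis syncA : synchronized A a.
Hypothesis syncB : synchronized B b.

Definition pmatch : pred (seq bool) :=
  amatch (fun c => pinit m (D c)) (fun c => @pstep m (D c)) (fun c => @pacc m (D c)).

Let syncD c : synchronized (D c) (s c). Proof. by case: c. Qed.

Let pad0 c u v : size u = size v ->
  pacc (D c) (arun (@pstep m (D c)) (pinit m (D c)) (false :: u) (false :: v))
  = pacc (D c) (arun (@pstep m (D c)) (pinit m (D c)) u v).
Proof. exact: (pacc_pad0 (startm c) (deltam c) (@syncD c)). Qed.

Let countE c v k := acount_occ (startm c) (deltam c) (@syncD c) v k.

(** Prefixes of Fibonacci length are cofinal among all prefixes, and every value has a valid word;
    matching at all words is therefore mutual domination at all values. *)
Lemma pmatch_permutation : (forall v, pmatch v) <-> is_permutation a b.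
Proof.
split=> [allm|/is_permutationP[dab dba] v].
  have dom c x k : exists k', occ (s c) x k <= occ (s (~~ c)) x k'.
    have [v [_ vv <-]] := fib_val_surj (fib_unbounded x.+1).
    have /(amatchP pad0)/(_ c k)[k'] := allm v.
    rewrite !countE vv !mul1n => le; exists (fib (k' + size v).+2).
    apply: leq_trans le; apply: occ_leq.
    exact: leq_trans (leq_addr _ _) (fib_unbounded _).
  by apply/is_permutationP; split=> x k; [apply: (dom true) | apply: (dom false)].
apply/(amatchP pad0) => c k.
have [k' le] : exists k', occ (s c) (fib_val v) (fib (k + size v).+2)
                        <= occ (s (~~ c)) (fib_val v) k' by case: (c).
exists k'; rewrite !countE leq_mul2l; apply/orP; right; apply: leq_trans le _.
by apply: occ_leq; apply: leq_trans (leq_addr _ _) (fib_unbounded _).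
Qed.

Lemma pmatch_bounded :
  (forall v, size v <= control_bound (pstate m) -> pmatch v) <-> is_permutation a b.
Proof.
by rewrite -pmatch_permutation; split=> [/(amatch_bounded pad0)|H v _].
Qed.

End Criterion.

(** * Agreement of the arithmetic procedure with the automata *)

Definition bits (n U : nat) : seq bool := mkseq (bit U) n.

Lemma bitS U i : bit U i.+1 = bit U./2 i.
Proof. by rewrite /bit; congr (odd _); elim: i => //= i ->. Qed.

Lemma bitsS n U : bits n.+1 U = odd U :: bits n U./2.
Proof.
rewrite /bits /mkseq /= -[1]/(1 + 0) iotaDl -map_comp; congr (_ :: _).
by apply: eq_map => i; rewrite /= bitS.
Qed.

Lemma bits_rcons n U : bits n.+1 U = rcons (bits n U) (bit U n).
Proof. exact: mkseqS. Qed.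

Lemma bit_double U i : bit (2 * U) i = (0 < i) && bit U i.-1.
Proof.
case: i => [|i]; first by rewrite /bit /= oddM.
by rewrite bitS mul2n doubleK.
Qed.

Lemma bits_pad k l V : bits (k + l) (V * 2 ^ k) = nseq k false ++ bits l V.
Proof.
elim: k => [|k IH]; first by rewrite muln1.
rewrite addSn bitsS /= expnS mulnCA -IH; congr (_ :: bits _ _).
  by rewrite oddM.
by rewrite mul2n doubleK.
Qed.

Lemma bits_surj w : exists2 U, U < 2 ^ size w & bits (size w) U = w.
Proof.
elim: w => [|b w [U ltU eU]]; first by exists 0.
exists (b + U.*2); first by rewrite /= expnS; case: b; lia.
by rewrite bitsS oddD odd_double oddb addbF half_bit_double eU.
Qed.

Lemma size_words n : size (words n) = 2 ^ n.
Proof. by elim: n => //= n IH; rewrite size_cat !size_map IH addnn -mul2n expnS. Qed.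

(** Every word is hit and both lists have length [2 ^ n], so no word is hit twice. *)
Lemma bits_words n : perm_eq (words n) [seq bits n U | U <- iota 0 (2 ^ n)].
Proof.
set s := map _ _; have sz : size s = size (words n).
  by rewrite size_map size_iota size_words.
have sub : {subset words n <= s}.
  move=> w; rewrite mem_words => /eqP sw; apply/mapP.
  by have [U] := bits_surj w; rewrite sw; exists U; rewrite ?mem_iota.
have [| _ eqi] := uniq_min_size (uniq_words n) sub; first by rewrite sz.
apply: uniq_perm => //; first exact: uniq_words.
by rewrite (uniq_size_uniq (uniq_words n) eqi) sz.
Qed.

Lemma code_nth0 D : code_nth (enc_dfa D) 0 = start D.
Proof. by rewrite /enc_dfa code_nthE. Qed.

Lemma code_nth1 D : code_nth (enc_dfa D) 1 = code_seq (delta D).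
Proof. by rewrite /enc_dfa code_nthE. Qed.

Lemma code_nth2 D : code_nth (enc_dfa D) 2 = code_seq (map nat_of_bool (final D)).
Proof. by rewrite /enc_dfa code_nthE. Qed.

Lemma run_codeE D n U V :
  run_code (enc_dfa D) n U V = run D (map letter (zip (bits n U) (bits n V))).
Proof.
rewrite /run_code code_nth0 code_nth1; elim: n => // n IH.
rewrite [LHS]/= IH !bits_rcons zip_rcons ?size_mkseq // map_rcons /run foldl_rcons.
by rewrite code_nthE.
Qed.

Lemma valid_codeE n U : valid_code n U = fib_valid (bits n U).
Proof.
rewrite /valid_code; elim: n => // n IH.
rewrite [LHS]/= IH bits_rcons fib_valid_rcons bit_double.
have -> : last false (bits n U) = (0 < n) && bit U n.-1.
  by case: (n) => // i; rewrite bits_rcons last_rcons.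
by case: (fib_valid _); case: (_ && _).
Qed.

(** Codes dominate their entries, which makes the code of an automaton a computable bound on its
    states. *)
Lemma nth_leq_code l i : nth 0 l i <= code_seq l.
Proof.
elim: l i => [|x l IH] [|i] //=; first exact: leqW (leq_cpairl _ _).
by apply: leq_trans (IH i) _; apply: leqW; apply: leq_cpairr.
Qed.

Lemma start_leq_enc D : start D <= enc_dfa D.
Proof. exact: (nth_leq_code [:: start D; _; _] 0). Qed.

Lemma delta_leq_enc D i : nth 0 (delta D) i <= enc_dfa D.
Proof.
apply: leq_trans (nth_leq_code _ _) _.
exact: (nth_leq_code [:: _; code_seq (delta D); _] 1).
Qed.

Lemma count_codeE m D l V k : start D <= m -> (forall i, nth 0 (delta D) i <= m) ->
  count_code (enc_dfa D) (k + l) (V * 2 ^ k)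
  = acount (pinit m D) (@pstep m D) (@pacc m D) (bits l V) k.
Proof.
move=> sm dm; rewrite /acount /asol size_filter size_mkseq (permP (bits_words _)).
rewrite count_map -sum1_count big_mkcond /count_code /=.
rewrite -(big_mkord xpredT (fun U => code_nth (code_nth (enc_dfa D) 2)
  (run_code (enc_dfa D) (k + l) U (V * 2 ^ k)) *
  (valid_code (k + l) U * valid_code (k + l) (V * 2 ^ k)))) /index_iota subn0.
apply: eq_bigr => U _; rewrite -bits_pad pacc_arun ?size_mkseq //.
rewrite code_nth2 code_nthE run_codeE !valid_codeE /accepts.
(* An entry missing from [final] reads as [false], and one missing from its numeric version as 0;
   the two defaults agree. *)
set q := run _ _; have -> : nth 0 (map nat_of_bool (final D)) q = nth false (final D) q.
  case: (ltnP q (size (final D))) => h; first by rewrite (nth_map false).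
  by rewrite !nth_default ?size_map.
by case: (nth _ _ _); case: (fib_valid _); case: (fib_valid _).
Qed.

(** The cardinality of [pstate (A + B)]; the factor 8 stands for its three boolean components. *)
Definition state_count (A B : nat) : nat := (A + B).+1 * 8.

Definition match_code (A B l V : nat) : bool :=
  let T := state_count A B in
  let cA := count_code A (T + l) (V * 2 ^ T) in
  let cA' := count_code A (2 * T + l) (V * 2 ^ (2 * T)) in
  let cB := count_code B (T + l) (V * 2 ^ T) in
  let cB' := count_code B (2 * T + l) (V * 2 ^ (2 * T)) in
  ((cA < cA' : nat) == (cB < cB') :> nat) && ((cA < cA') || (cA == cB)).

(** The successor is there because words of length equal to [control_bound] are tested too. *)
Definition bound_code (A B : nat) : nat :=
  let T := state_count A B in (2 ^ T * 2 ^ T * (2 * T)).+1.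

Definition decide (A B : nat) : bool :=
  \sum_(l < bound_code A B) \sum_(V < 2 ^ l) ~~ match_code A B l V == 0.

Lemma computable_match_code n f1 f2 f3 f4 :
  computable n f1 -> computable n f2 -> computable n f3 -> computable n f4 ->
  computable n (fun v => match_code (f1 v) (f2 v) (f3 v) (f4 v)).
Proof.
apply: (@computable_comp4 n (fun A B l V => nat_of_bool (match_code A B l V))).
rewrite /match_code /state_count.
by computability; apply: computable_count_code; computability.
Qed.

Lemma computable_decide : computable 2 (fun v => decide (nth 0 v 0) (nth 0 v 1)).
Proof.
rewrite /decide; computability.
apply: (@computable_sum _ _ (fun l v =>
  \sum_(V < 2 ^ l) ~~ match_code (nth 0 v 0) (nth 0 v 1) l V)).
  by rewrite /bound_code /state_count; computability.
apply: (@computable_sum _ _ (fun V v =>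
  nat_of_bool (~~ match_code (nth 0 (behead v) 0) (nth 0 (behead v) 1)
    (nth 0 v 0) V))); computability.
by apply: computable_match_code; computability.
Qed.

Lemma decideP A B a b : synchronized A a -> synchronized B b ->
  decide (enc_dfa A) (enc_dfa B) <-> is_permutation a b.
Proof.
move=> syncA syncB; set m := enc_dfa A + enc_dfa B.
have startA : start A <= m by rewrite (leq_trans (start_leq_enc _)) ?leq_addr.
have startB : start B <= m by rewrite (leq_trans (start_leq_enc _)) ?leq_addl.
have deltaA i : nth 0 (delta A) i <= m.
  by rewrite (leq_trans (delta_leq_enc _ _)) ?leq_addr.
have deltaB i : nth 0 (delta B) i <= m.
  by rewrite (leq_trans (delta_leq_enc _ _)) ?leq_addl.
have cardQ : #|pstate m| = state_count (enc_dfa A) (enc_dfa B).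
  by rewrite !card_prod !card_bool card_ord /state_count -!mulnA.
have matchE l V : match_code (enc_dfa A) (enc_dfa B) l V = pmatch m A B (bits l V).
  rewrite /match_code /pmatch /amatch /ainf !(@count_codeE m) // cardQ.
  by congr (_ && _); case: (_ < _); case: (_ < _).
rewrite -(@pmatch_bounded m A B a b) //; [|by case|by case].
have boundE : bound_code (enc_dfa A) (enc_dfa B) = (control_bound (pstate m)).+1.
  by rewrite /control_bound cardQ.
rewrite /decide boundE sum_nat_eq0; split.
  move=> /forallP all0 v sv; have /= := all0 (Ordinal (sv : size v < _.+1)).
  rewrite sum_nat_eq0 => /forallP/=; have [V ltV <-] := bits_surj v.
  by rewrite size_mkseq => /(_ (Ordinal ltV)); rewrite eqb0 negbK matchE.
move=> allm; apply/forallP => l /=; rewrite sum_nat_eq0; apply/forallP => V /=.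
by rewrite eqb0 negbK matchE allm // size_mkseq -ltnS.
Qed.

Theorem theorem10 :
  exists P : prec_fun,
    forall (A B : dfa) (a b : nat -> nat),
      synchronized A a -> synchronized B b ->
      (is_permutation a b -> peval P [:: enc_dfa A; enc_dfa B] 1) /\
      (~ is_permutation a b -> peval P [:: enc_dfa A; enc_dfa B] 0).
Proof.
have [P HP] := computable_decide.
exists P => A B a b syncA syncB.
have := HP [:: enc_dfa A; enc_dfa B] erefl; rewrite /=.
have := decideP syncA syncB; case: (decide _ _) => -[d1 d2] ev; split=> // perm.
  by case: perm; apply: d1.
by have := d2 perm.
Qed.
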